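(* Let $n \geqslant 2$, let $F_n$ be the free group of rank $n$ with basis $\{x_1,\dots,x_n\}$, and let $\mathrm{Pr}_n$ be the set of all primitive elements of $F_n$. Then $\rho(\mathrm{Pr}_n)=0$. More precisely, if $n \geqslant 3$ and $P(n,k)$ denotes the number of primitive elements of length $k$ in $F_n$, then there are constants $c_1, c_2 > 0$ (depending on $n$ but not on $k$) such that for all $k \geqslant 1$ $$c_1 \cdot (2n-3)^k \leqslant P(n,k) \leqslant c_2\cdot (2n-2)^k .$$
   Context: The length of an element of $F_n$ is the length of the reduced word in $x_1^{\pm1},\dots,x_n^{\pm 1}$ representing it. An element $u\in F_n$ is primitive if it is part of a free basis of $F_n$, equivalently if $\alpha(u)=x_1$ for some $\alpha\in \mathrm{Aut}(F_n)$. Let $C_k$ be the set of elements of length exactly $k$ and $B_k$ the set of elements of length at most $k$. For $S\subseteq F_n$, $\rho(S)$ denotes the standard asymptotic density of $S$, spherical or disc, i.e. $\lim_{k\to\infty}|S\cap C_k|/|C_k|$ or $\lim_{k\to\infty}|S\cap B_k|/|B_k|$; the assertion $\rho(S)=0$ means that these limits exist and equal $0$. *)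

(* Defs.v *)
From HB Require Import structures.
From mathcomp Require Import all_boot all_order all_algebra finmap.
From mathcomp Require Import all_classical all_reals all_analysis.

Set Implicit Arguments.
Unset Strict Implicit.
Unset Printing Implicit Defensive.

Import Order.TTheory GRing.Theory Num.Theory.
Import numFieldNormedType.Exports.

Local Open Scope classical_set_scope.

(* The letter (a, false) is the generator a, and (a, true) is its inverse. *)
Definition inv_letter (A : Type) (l : A * bool) : A * bool := (l.1, ~~ l.2).

Definition reduced (A : choiceType) (w : seq (A * bool)) : bool :=
  sorted (fun l m : A * bool => m != inv_letter l) w.

(* The free group on A, represented by reduced words: by uniqueness of reduced
   forms, its Leibniz equality is equality in the free group. *)
Record free_group (A : choiceType) : Type := FreeGroup {
  word :> seq (A * bool);
  word_reduced : reduced word }.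

HB.instance Definition _ (A : choiceType) := [isSub for @word A].
HB.instance Definition _ (A : choiceType) := [Choice of free_group A by <:].

Section FreeGroup.
Variable A : choiceType.
Implicit Types (l : A * bool) (w : seq (A * bool)) (u v : free_group A).

Definition push l w : seq (A * bool) :=
  if w is m :: w' then if m == inv_letter l then w' else l :: w else [:: l].

Definition reduce w : seq (A * bool) := foldr push [::] w.

Lemma inv_letterK : involutive (@inv_letter A).
Proof. by case=> a b; rewrite /inv_letter /= negbK. Qed.

Lemma push_reduced l w : reduced w -> reduced (push l w).
Proof.
case: w => [//|m w] rw /=; case: ifPn => [_|ml]; last by rewrite /reduced /= ml.
exact: path_sorted rw.
Qed.

Lemma foldr_push_reduced w w' : reduced w' -> reduced (foldr push w' w).
Proof. by move=> rw'; elim: w => //= l w; apply: push_reduced. Qed.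

Lemma pushK l w : reduced w -> push l (push (inv_letter l) w) = w.
Proof.
case: w => [_|m w] /=; first by rewrite eqxx.
rewrite inv_letterK; case: (eqVneq m l) => [->|ml _ /=]; last by rewrite eqxx.
by case: w => [//|k w] /= /andP[/negPf->].
Qed.

Lemma pushVK l w : reduced w -> push (inv_letter l) (push l w) = w.
Proof. by move=> rw; rewrite -{2}[l]inv_letterK pushK. Qed.

Lemma foldr_push l w w' :
  reduced w' -> foldr push w' (push l w) = push l (foldr push w' w).
Proof.
move=> rw'; case: w => [//|m w] /=; case: (eqVneq m (inv_letter l)) => [->|//].
by rewrite pushK// foldr_push_reduced.
Qed.

Lemma reduce_id w : reduced w -> reduce w = w.
Proof.
elim: w => [//|l w IHw] rlw; rewrite /= -/(reduce w) IHw.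
  by case: w rlw {IHw} => [//|m w] /= /andP[/negPf->].
exact: path_sorted rlw.
Qed.

Definition fg_mul u v : free_group A :=
  FreeGroup (foldr_push_reduced u (word_reduced v)).

Lemma fg_mulE u v : word (fg_mul u v) = reduce (u ++ v).
Proof. by rewrite /reduce foldr_cat -/(reduce v) reduce_id// word_reduced. Qed.

Definition fg_one : free_group A := @FreeGroup A [::] isT.

Lemma inv_reduced u : reduced (rev (map (@inv_letter A) u)).
Proof.
rewrite /reduced rev_sorted sorted_map.
apply: sub_sorted (word_reduced u) => l m /=.
by apply: contra => /eqP /(can_inj inv_letterK) ->; rewrite inv_letterK.
Qed.

Definition fg_inv u : free_group A := FreeGroup (inv_reduced u).

Lemma fg_mulA : associative fg_mul.
Proof.
move=> u v w; apply: val_inj => /=.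
elim: (word u) => [//|l s IHs] /=.
by rewrite IHs foldr_push// word_reduced.
Qed.

Lemma fg_mul1g : left_id fg_one fg_mul.
Proof. by move=> u; apply: val_inj. Qed.

Lemma fg_mulg1 : right_id fg_one fg_mul.
Proof.
move=> u; apply: val_inj; rewrite /= -/(reduce u) reduce_id//.
exact: word_reduced.
Qed.

Lemma foldr_pushV s w : reduced w ->
  foldr push (foldr push w s) (rev (map (@inv_letter A) s)) = w.
Proof.
elim: s w => [//|l s IHs] w rw /=.
by rewrite rev_cons -cats1 foldr_cat /= pushVK ?foldr_push_reduced// IHs.
Qed.

Lemma fg_mulVg : left_inverse fg_one fg_inv fg_mul.
Proof.
move=> u; apply: val_inj.
rewrite /= -[X in foldr _ X _](reduce_id (word_reduced u)).
exact: foldr_pushV.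
Qed.

Lemma fg_mulgV : right_inverse fg_one fg_inv fg_mul.
Proof.
have invK u : fg_inv (fg_inv u) = u.
  apply: val_inj; rewrite /= map_rev revK -map_comp map_id_in// => l _ /=.
  exact: inv_letterK.
by move=> u; rewrite -{1}[u]invK fg_mulVg.
Qed.

HB.instance Definition _ := isGroup.Build (free_group A)
  fg_mulA fg_mul1g fg_mulg1 fg_mulVg fg_mulgV.

Definition gen (a : A) : free_group A := @FreeGroup A [:: (a, false)] isT.

Definition fg_length u : nat := size (word u).

End FreeGroup.

(* The homomorphism free_group A -> G extending f : A -> G. *)
Definition fg_lift (A : choiceType) (G : groupType) (f : A -> G)
    (w : free_group A) : G :=
  (\prod_(l <- word w) (if l.2 then (f l.1)^-1 else f l.1))%g.

Lemma fg_lift_gen (A : choiceType) (G : groupType) (f : A -> G) (a : A) :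
  fg_lift f (gen a) = f a.
Proof. by rewrite /fg_lift big_seq1. Qed.

Lemma fg_liftM (A : choiceType) (G : groupType) (f : A -> G) :
  {morph fg_lift f : u v / (u * v)%g}.
Proof.
move=> u v; rewrite /fg_lift /=; elim: (word u) => [|l s IHs] /=.
  by rewrite big_nil mul1g.
rewrite big_cons -mulgA -IHs; case: (foldr _ _ _) => [|m w] /=.
  by rewrite big_seq1 big_nil mulg1.
case: eqP => [->|_]; last by rewrite big_cons.
by rewrite big_cons /=; case: (l.2); rewrite /= ?mulKg ?mulVKg.
Qed.

(* B is a free basis of G when the homomorphism from the free group on B to G
   induced by the inclusion is an isomorphism. *)
Definition free_basis (G : groupType) (B : set G) : Prop :=
  bijective (fg_lift (fun b : B => val b)).

(* The free group F_n of rank n. *)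
Notation freeG n := (free_group 'I_n).

Definition primitive (n : nat) : set (freeG n) :=
  [set u | exists2 B : set (freeG n), free_basis B & B u].

Definition sphere (n k : nat) : set (freeG n) := [set u | fg_length u = k].

Definition disc (n k : nat) : set (freeG n) := [set u | (fg_length u <= k)%N].

Arguments primitive n : clear implicits.
Arguments sphere n k : clear implicits.
Arguments disc n k : clear implicits.

Lemma finite_disc n k : finite_set (disc n k).
Proof.
pose W := [set w : seq ('I_n * bool) | (size w <= k)%N].
suff fW : finite_set W.
  apply: (@finite_preimage _ _ W (@word 'I_n)) fW => u v _ _; exact: val_inj.
suff -> : W = \bigcup_(i in `I_k.+1) (range (@tval i ('I_n * bool)%type)).
  by apply: bigcup_finite => // i _; apply: finite_image; apply: finite_finset.
apply/seteqP; split=> [w wk|w [i /= ik [t _ <-]]].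
  by exists (size w) => //; exists (in_tuple w).
by rewrite /W /= size_tuple.
Qed.

Lemma finite_sphere n k : finite_set (sphere n k).
Proof.
by apply: sub_finite_set (finite_disc n k) => u; rewrite /sphere /disc /= => ->.
Qed.

(* Number of elements; only meaningful for finite X, where fset_set X has the
   same elements as X. *)
Definition setcard (T : choiceType) (X : set T) : nat := #|` fset_set X|.

(* rho(S) = d for both the spherical and the disc asymptotic densities. *)
Definition has_density (R : realType) (n : nat) (S : set (freeG n)) (d : R) :
    Prop :=
  ((fun k => (setcard (S `&` sphere n k))%:R / (setcard (sphere n k))%:R : R)%R
     @ \oo --> d) /\
  ((fun k => (setcard (S `&` disc n k))%:R / (setcard (disc n k))%:R : R)%R
     @ \oo --> d).

Definition num_primitive (n k : nat) : nat :=
  setcard (primitive n `&` sphere n k).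

(* Main.v *)
(** A member [u] of a basis translates by right multiplication inside each half
    of the tree of that basis cut along an edge labelled by another basis element
    [y].  Transported to the Cayley tree of the standard basis, this is a
    colouring with finite coboundary, both colours unbounded, constant along all
    translates of the axis of [u].  At a deepest vertex where the colours at
    infinity are still mixed, all directions but the backward one [v] are
    monochromatic, so [v] separates the Whitehead graph of the cyclically reduced
    core of [u] (Whitehead's cut vertex lemma).  For each of the finitely many
    possible separations, a positive weight [f] on letters such that the sum of
    [f] over the letters allowed after [x] is at most [(2n-2) f x] bounds the
    number of such words of length k by a multiple of [(2n-2)^k]; summing over
    conjugators costs only a constant factor because [2n-1 < (2n-2)^2].  The
    lower bound counts the primitive elements [x_1 g] with [g] in the subgroup
    generated by the other generators. *)
Require Import Defs.
From mathcomp Require Import all_boot all_order all_algebra finmap.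
From mathcomp Require Import all_classical all_reals all_analysis.
From mathcomp Require Import zify.

Import Order.TTheory GRing.Theory Num.Theory.
Import numFieldNormedType.Exports.

Set Implicit Arguments.
Unset Strict Implicit.
Unset Printing Implicit Defensive.

(** * Reduced words, cyclic reduction and homomorphisms on free groups *)

Section FreeGroupWords.
Variable A : choiceType.
Implicit Types (l x y : A * bool) (s t w : seq (A * bool)) (u v g h : free_group A).

(** A word is reduced when consecutive letters satisfy this relation, and [cycle nocancel] expresses
    that it is cyclically reduced. *)
Definition nocancel x y := y != inv_letter x.

Lemma inv_letter_inj : injective (@inv_letter A).
Proof. exact: can_inj (@inv_letterK A). Qed.

Lemma word_inj : injective (@word A).
Proof. exact: val_inj. Qed.

Lemma nocancel_inv x y : nocancel (inv_letter y) (inv_letter x) = nocancel x y.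
Proof.
by rewrite /nocancel inv_letterK eq_sym.
Qed.

Lemma reduced_glue s y t :
  reduced (s ++ y :: t) = reduced (rcons s y) && reduced (y :: t).
Proof.
exact: sorted_cat_cons.
Qed.

Lemma reduced_catl s t : reduced (s ++ t) -> reduced s.
Proof. by move=> /cat_sorted2[]. Qed.

Lemma reduced_catr s t : reduced (s ++ t) -> reduced t.
Proof. by move=> /cat_sorted2[]. Qed.

Lemma cycle_pow s i : cycle nocancel s -> cycle nocancel (flatten (nseq i s)).
Proof.
case: s => [|x s]; first by elim: i.
move=> cs; elim: i => [//|i IHi].
case: i IHi => [|i] IHi; first by rewrite /= cats0.
by rewrite /= -cat_rcons rcons_cat cat_path last_rcons; apply/andP.
Qed.

Lemma cycle_reduced s : cycle nocancel s -> reduced s.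
Proof. by case: s => // x s; rewrite /= rcons_path => /andP[]. Qed.

Lemma word_mul u v : reduced (word u ++ word v) -> word (u * v)%g = word u ++ word v.
Proof. by move=> r; rewrite -[LHS]/(word (fg_mul u v)) fg_mulE reduce_id. Qed.

Lemma word_exp u i :
  cycle nocancel (word u) -> word (u ^+ i)%g = flatten (nseq i (word u)).
Proof.
move=> cu; elim: i => [//|i IHi]; rewrite expgS word_mul IHi//.
exact: (cycle_reduced (cycle_pow i.+1 cu)).
Qed.

Lemma word_inv u : word (u^-1)%g = rev (map (@inv_letter A) (word u)).
Proof. by []. Qed.

Lemma cycle_inv s : cycle nocancel s -> cycle nocancel (rev (map (@inv_letter A) s)).
Proof.
rewrite rev_cycle cycle_map; apply: sub_cycle => x y /=.
by rewrite nocancel_inv.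
Qed.

Definition letter l : free_group A := @FreeGroup A [:: l] isT.

Lemma letter_inv l : letter (inv_letter l) = (letter l)^-1%g.
Proof. exact: word_inj. Qed.

Lemma letter_gen l : letter l = (if l.2 then (gen l.1)^-1 else gen l.1)%g.
Proof. by case: l => a [] /=; apply: val_inj. Qed.

Lemma word_mul_letter h s z l : word h = rcons s z ->
  word (h * letter l)%g = if nocancel z l then rcons (rcons s z) l else s.
Proof.
move=> hs; rewrite -[LHS]/(word (fg_mul h (letter l))) fg_mulE /= hs.
have rs : reduced (rcons s z) by rewrite -hs word_reduced.
case: ifPn => [zl|/negPn/eqP ->].
  rewrite cats1 reduce_id//.
  rewrite -[rcons (rcons _ _) _]cats1 cat_rcons reduced_glue rs.
  by rewrite /reduced /= andbT.
rewrite cat_rcons /reduce foldr_cat /= eqxx -/(reduce s) reduce_id//.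
by move: rs; rewrite -cats1 => /reduced_catl.
Qed.

Lemma word_cons u x s : word u = x :: s ->
  exists2 v : free_group A, u = (letter x * v)%g & word v = s.
Proof.
move=> us; have rs : reduced s.
  by have := word_reduced u; rewrite us -cat1s => /reduced_catr.
exists (FreeGroup rs) => //; apply: val_inj => /=.
by have := word_reduced u; rewrite us; case: s rs {us} => //= y s _ /andP[/negPf ->].
Qed.

Lemma free_group_ind (P : free_group A -> Prop) :
  P 1%g -> (forall x u, P u -> P (letter x * u)%g) -> forall u, P u.
Proof.
move=> P1 PM u; elim: (word u) {-2}u (erefl (word u)) => [v v0|x s IHs v vs].
  by have -> : v = 1%g by apply: val_inj.
by have [w -> ws] := word_cons vs; apply: PM; apply: IHs.
Qed.

Lemma fg_length_mul u v : fg_length (u * v)%g <= fg_length u + fg_length v.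
Proof.
rewrite /fg_length /=.
elim: (word u) => [//|x s IHs] /=; rewrite addSn.
apply: (@leq_trans (size (foldr (@push A) (word v) s)).+1); last by rewrite ltnS.
by case: (foldr _ _ _) => [//|y w] /=; case: ifP => //= _; rewrite leqW.
Qed.

Lemma fg_length_inv u : fg_length (u^-1)%g = fg_length u.
Proof. by rewrite /fg_length word_inv size_rev size_map. Qed.

Lemma fg_length_sub h v : fg_length h <= fg_length (h * v)%g + fg_length v.
Proof.
by rewrite -[in leqLHS](mulgK v h) -(fg_length_inv v) fg_length_mul.
Qed.

Lemma fg_lift1 (G : groupType) (f : A -> G) : fg_lift f 1%g = 1%g.
Proof. by rewrite /fg_lift big_nil. Qed.

Lemma fg_lift_letter (G : groupType) (f : A -> G) x :
  fg_lift f (letter x) = (if x.2 then (f x.1)^-1 else f x.1)%g.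
Proof. by rewrite /fg_lift big_seq1. Qed.

Lemma fg_liftV (G : groupType) (f : A -> G) u : fg_lift f u^-1%g = (fg_lift f u)^-1%g.
Proof. by apply: (mulgI (fg_lift f u)); rewrite -fg_liftM !mulgV fg_lift1. Qed.

Lemma morph_ext (G : groupType) (f1 f2 : free_group A -> G) :
  {morph f1 : u v / (u * v)%g} -> {morph f2 : u v / (u * v)%g} ->
  (forall a, f1 (gen a) = f2 (gen a)) -> f1 =1 f2.
Proof.
move=> m1 m2 e.
have one (f : free_group A -> G) : {morph f : u v / (u * v)%g} -> f 1%g = 1%g.
  by move=> m; apply: (mulgI (f 1%g)); rewrite -m !mulg1.
have inv (f : free_group A -> G) (m : {morph f : u v / (u * v)%g}) u :
    f u^-1%g = (f u)^-1%g.
  by apply: (mulgI (f u)); rewrite -m !mulgV one.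
elim/free_group_ind => [|x u IHu]; first by rewrite !one.
by rewrite m1 m2 IHu letter_gen; case: (x.2); rewrite ?inv// e.
Qed.

End FreeGroupWords.

Arguments nocancel {A}.
Arguments inv_letter_inj {A}.

(** * Two-coloured splittings of the Cayley tree, and why primitive elements have them *)

Section Splittings.
Variable A : choiceType.
Implicit Types (x l : A * bool) (u g h q : free_group A).

(* [c] cuts the Cayley tree into two unbounded parts with finite coboundary, and
   [u] translates every vertex on the right within its part. *)
Definition splits u (c : free_group A -> bool) : Prop :=
  [/\ forall g, c (g * u)%g = c g,
      forall q, exists N, forall h, N <= fg_length h -> c (h * q)%g = c h
    & forall b N, exists2 h, N <= fg_length h & c h = b].

Definition splittable u : Prop := exists c, splits u c.

(** The colouring is transported by right translation by [q^-1]. This changes lengths by at most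
    that of [q], so the coboundary stays finite and both colours stay unbounded. *)
Lemma splittable_conj u q : splittable u -> splittable (q^-1 * u * q)%g.
Proof.
case=> c [cu cq cN]; exists (fun g => c (g * q^-1)%g); split=> [g|p|b N].
- by rewrite !mulgA mulgK cu.
- have [[N1 c1] [N2 c2]] := (cq q^-1%g, cq p).
  exists (N1 + N2 + fg_length p) => h hN; have hp := fg_length_sub h p.
  by rewrite !(c1, c2)//; lia.
- have [h hN <-] := cN b (N + fg_length q).
  exists (h * q)%g; last by rewrite mulgK.
  by have := fg_length_sub h q; lia.
Qed.

(** Right multiplication by a letter acts at the end of a reduced word, so it reaches the first
    letter only on the edge between 1 and [inv_letter l], which the hypotheses exclude. *)
Lemma ohead_mul_letter h l :
    word h != [::] -> word h != [:: inv_letter l] ->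
  ohead (word (h * letter l)%g) = ohead (word h).
Proof.
move: (erefl (word h)); case: {2 3 4 5}(word h) / lastP => // s z hs _ szl.
rewrite (word_mul_letter l hs); case: ifPn => [_|/negPn/eqP zl].
  by case: s {hs szl}.
by case: s hs szl => //= _; rewrite zl inv_letterK eqxx.
Qed.

(** The words beginning with [x] are joined to the rest of the tree by the single edge from 1 to
    [x], and multiplication by [l] never travels along an edge with that label. *)
Lemma ohead_mul_letter_eq h l x : l != x -> inv_letter l != x ->
  (ohead (word (h * letter l)%g) == Some x) = (ohead (word h) == Some x).
Proof.
move=> lx lVx.
have [h0|h0] := eqVneq (word h) [::].
  have -> : h = 1%g by apply: val_inj.
  by rewrite mul1g /=; apply/eqP => -[/eqP]; apply/negP.
have [hl|hl] := eqVneq (word h) [:: inv_letter l]; last by rewrite ohead_mul_letter.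
rewrite (@word_mul_letter _ h [::] (inv_letter l))// /nocancel inv_letterK eqxx /= hl.
by apply/esym/eqP => -[/eqP]; apply/negP.
Qed.

Lemma word_letter_exp l i : word (letter l ^+ i)%g = nseq i l.
Proof.
rewrite word_exp /=; first by elim: i => //= i ->.
by rewrite /nocancel andbT; case: l => a []; rewrite xpair_eqE eqxx.
Qed.

End Splittings.

Lemma injective_unbounded n (f : nat -> freeG n) :
  injective f -> forall N, exists k, N <= fg_length (f k).
Proof.
move=> finj N; apply: contrapT => noK; apply: infinite_nat.
apply: sub_finite_set (finite_preimage (f := f) _ (finite_disc n N)).
  move=> k _ /=; rewrite /disc /= leqNgt; apply/negP => /ltnW kN.
  by apply: noK; exists k.
by move=> i j _ _; apply: finj.
Qed.

(** Otherwise every element would be a product of copies of [u] and its inverse, and the group would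
    be abelian. *)
Lemma basis_nontrivial n (B : set (freeG n)) (u : freeG n) : 2 <= n ->
  free_basis B -> exists2 y, B y & y != u.
Proof.
move=> n2 [psi _ psiK]; apply: contrapT => noy.
have uB (b : B) : val b = u.
  apply: contrapT => /eqP bu; apply: noy; exists (val b) => //.
  exact: set_valP.
have gu (g : freeG n) : commute u g.
  rewrite -(psiK g) /fg_lift; apply: commute_prod => -[b e] _ /=.
  by rewrite uB; case: e => /=; [apply: commuteV|]; apply: commute_refl.
have gh (g h : freeG n) : commute h g.
  rewrite -(psiK g) /fg_lift; apply: commute_prod => -[b e] _ /=.
  rewrite uB; apply: commute_sym; case: e => //=.
  by apply: commute_sym; apply: commuteV; apply: commute_sym.
have := gh (gen (Ordinal n2)) (gen (Ordinal (ltnW n2))).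
by move=> /(congr1 (fun w => ohead (word w))).
Qed.

Lemma primitive_splittable n (u : freeG n) :
  2 <= n -> primitive n u -> splittable u.
Proof.
move=> n2 [B fB Bu]; have [y' By' y'u] := basis_nontrivial u n2 fB.
pose y : B := SigSub (mem_set By'); pose z : B := SigSub (mem_set Bu).
have zy : z != y by rewrite -(inj_eq val_inj) eq_sym.
case: fB; set lift := fg_lift _ => psi liftK psiK.
have liftM : {morph lift : v w / (v * w)%g} by exact: fg_liftM.
have psiM : {morph psi : g h / (g * h)%g}.
  by move=> g h; apply: (can_inj liftK); rewrite liftM !psiK.
have lift_z : lift (letter (z, false)) = u by rewrite /lift fg_lift_letter.
(* The colour of [h] records whether its reduced expression in the basis [B] begins with [y], which
   is one side of a [y]-edge in the tree of [B]. *)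
pose a := (y, false); pose c h := ohead (word (psi h)) == Some a.
exists c; split=> [g|q|b N].
- rewrite -lift_z /c psiM liftK ohead_mul_letter_eq//.
    by apply: contra zy => /eqP/(congr1 fst)/= ->.
  by apply: contra zy => /eqP[].
- rewrite -(psiK q); elim/free_group_ind: (psi q) => [|l w [N cN]].
    by exists 0 => h _; rewrite /lift fg_lift1 mulg1.
  pose L k := fg_length (lift (letter k)).
  (* The first two terms keep [h * lift (letter l)] at length at least [N]; the last makes [h]
     longer than the images of 1 and of [inv_letter l], the two ends of the edge where the colour
     may change. *)
  exists (N + L l + (L (inv_letter l)).+1) => h hN.
  rewrite liftM mulgA cN; last first.
    rewrite -(leq_add2r (L l)); apply: leq_trans (fg_length_sub _ _).
    by apply: leq_trans hN; apply: leq_addr.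
  have hl w' : fg_length (lift w') < fg_length h -> word (psi h) != word w'.
    by apply: contraTN => /eqP/val_inj <-; rewrite psiK ltnn.
  rewrite /c psiM liftK ohead_mul_letter//.
    apply: (hl 1%g); rewrite /lift fg_lift1; apply: leq_trans hN.
    by rewrite addnS ltnS leq0n.
  apply: (hl (letter (inv_letter l))); apply: leq_trans hN.
  by rewrite addnS ltnS leq_addl.
(* Positive powers of [y] have colour true and negative powers colour false. They are pairwise
   distinct, hence unbounded in length since balls are finite. *)
- pose f k := lift (letter (y, ~~ b) ^+ k.+1)%g.
  have finj : injective f.
    move=> i j /(can_inj liftK)/(congr1 (fun w => size (word w))).
    by rewrite !word_letter_exp !size_nseq => -[].
  have [k kN] := injective_unbounded finj N; exists (f k) => //.
  by rewrite /c liftK word_letter_exp; case: b {f finj kN}; apply/eqP; last by case.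
Qed.

(* An edge of the Whitehead graph of a word joins [inv_letter x] to [y] whenever
   [x y] is a subword; [turn v S] says that this edge meets [v] or does not cross
   from [S] to its complement. *)
Definition turn n (v : 'I_n * bool) (S : {ffun 'I_n * bool -> bool}) :
    rel ('I_n * bool) :=
  fun x y => nocancel x y && [|| inv_letter x == v, y == v | S (inv_letter x) == S y].

Definition nontrivial_cut n (v : 'I_n * bool) (S : {ffun 'I_n * bool -> bool}) :=
  [exists a, (a != v) && S a] && [exists b, (b != v) && ~~ S b].

Lemma expg_intertwine (G : groupType) (r q e : G) i :
  (r * q = q * e)%g -> (r ^+ i * q = q * e ^+ i)%g.
Proof.
move=> rq; elim: i => [|i IHi]; first by rewrite mul1g mulg1.
by rewrite expgS -mulgA IHi mulgA rq -mulgA -expgS.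
Qed.

(** * Whitehead's cut vertex lemma, read off from a splitting *)

Section CutVertex.
Variables (n : nat) (u : freeG n) (c : freeG n -> bool).
Hypotheses (n2 : 2 <= n) (uc : splits u c).
Implicit Types (x y v : 'I_n * bool) (g h r : freeG n).

(** There are finitely many letters, so one bound covers all edges where the colour changes; beyond
    it every step away from the root preserves the colour. *)
Lemma splits_prefix : exists N, forall g h t,
  N <= fg_length g -> word h = word g ++ t -> c h = c g.
Proof.
have [_ cq _] := uc.
have /choice[Nf NfP] l := cq (letter l).
exists (\max_l Nf l) => g h t gN; elim/last_ind: t h => [|t x IHt] h ht.
  by rewrite cats0 in ht; congr c; apply: val_inj.
have rh := word_reduced h; rewrite ht -rcons_cat in rh.
have rh' : reduced (word g ++ t) by move: rh; rewrite -cats1 => /reduced_catl.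
rewrite -(IHt (FreeGroup rh'))//.
have -> : h = (FreeGroup rh' * letter x)%g.
  by apply: word_inj; rewrite ht word_mul; rewrite /= cats1 rcons_cat -?rcons_cat.
rewrite NfP//; apply: leq_trans (leq_bigmax x) _; apply: leq_trans gN _.
by rewrite /fg_length /= size_cat leq_addr.
Qed.

Lemma exists_third (a b : 'I_n * bool) : exists v, (a != v) && (b != v).
Proof.
apply: contrapT => nov.
have : #|{: 'I_n * bool}| <= #|[:: a; b]|.
  apply: subset_leq_card; apply/fintype.subsetP => v _; rewrite !inE.
  by apply: contrapT => /negP; rewrite negb_or !(eq_sym v) => av; apply: nov; exists v.
have := leq_trans _ (card_size [:: a; b]) => /[apply] /=.
by rewrite card_prod card_ord card_bool; lia.
Qed.

(* At a deepest vertex [g] whose shadow contains both colours at infinity, the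
   shadows of all forward directions are monochromatic; [v] points backward. *)
Lemma extremal_vertex : exists g v S N,
  [/\ nontrivial_cut v S,
      forall y, y != v -> reduced (rcons (word g) y)
    & forall h y t, N <= fg_length h -> word h = rcons (word g) y ++ t -> c h = S y].
Proof.
have [_ _ cN] := uc; have [N NP] := splits_prefix.
pose shade s b := exists h, [/\ N <= fg_length h, exists t, word h = s ++ t & c h = b].
pose mixed k := `[< exists2 g, fg_length g = k & forall b, shade (word g) b >].
have mixed0 : mixed 0.
  apply/asboolP; exists 1%g => // b; have [h hN hb] := cN b N.
  by exists h; split=> //; exists (word h).
have mixedN k : mixed k -> k <= N.
  move=> /asboolP[g gk gs]; rewrite leqNgt; apply/negP => /ltnW Nk.
  have [h1 [_ [t1 h1t] c1]] := gs true; have [h2 [_ [t2 h2t] c2]] := gs false.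
  by move: c1 c2; rewrite (NP g h1 t1) ?gk// (NP g h2 t2) ?gk// => ->.
case: (ex_maxnP (ex_intro _ 0 mixed0) mixedN) => k /asboolP[g gk gs] kmax.
(* A mixed shadow one step beyond [g] would contradict the maximality of [k]. *)
have mono y : ~ forall b, shade (rcons (word g) y) b.
  move=> ys; have [h [_ [t ht] _]] := ys true.
  have ry : reduced (rcons (word g) y).
    by have := word_reduced h; rewrite ht => /reduced_catl.
  suff /kmax : mixed k.+1 by rewrite ltnn.
  by apply/asboolP; exists (FreeGroup ry) => //; rewrite /fg_length /= size_rcons -gk.
pose S := [ffun y => `[< shade (rcons (word g) y) true >]].
have SP h y t : N <= fg_length h -> word h = rcons (word g) y ++ t -> c h = S y.
  move=> hN ht; have yh : shade (rcons (word g) y) (c h) by exists h; split=> //; exists t.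
  rewrite ffunE; case ch: (c h) yh => yh; first by apply/esym/asboolP.
  by apply/esym/asboolP => ys; apply: (mono y) => -[].
(* Since [g] is shorter than [N], a vertex of length at least [N] in its shadow has a further
   letter, which gives its direction from [g]. *)
have kN : k < N.
  rewrite ltnNge -gk; apply/negP => Nk.
  have [h1 [_ [t1 h1t] c1]] := gs true; have [h2 [_ [t2 h2t] c2]] := gs false.
  by move: c1 c2; rewrite (NP g h1 t1)// (NP g h2 t2)// => ->.
have dir b : exists y, S y = b /\ reduced (rcons (word g) y).
  have [h [hN [[|y t] ht] <-]] := gs b.
    by move: hN; rewrite /fg_length ht cats0 -/(fg_length g) gk leqNgt kN.
  rewrite -cat_rcons in ht; exists y; split; first by rewrite (SP h y t).
  by have := word_reduced h; rewrite ht => /reduced_catl.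
have [a [Sa ra]] := dir true; have [b [Sb rb]] := dir false.
suff [v [av bv vP]] : exists v,
    [/\ a != v, b != v & forall y, y != v -> reduced (rcons (word g) y)].
  exists g, v, S, N; split=> //.
  by apply/andP; split; apply/existsP; [exists a; rewrite av Sa|exists b; rewrite bv Sb].
have rg := word_reduced g.
(* At the root there is no backward direction, and any letter other than [a] and [b] can serve as
   [v]; elsewhere [v] undoes the last letter of [g]. *)
case/lastP: (word g) ra rb rg => [|s z] ra rb rg.
  by have [v /andP[av bv]] := exists_third a b; exists v; split.
have rz y : reduced (rcons (rcons s z) y) = (y != inv_letter z).
  by rewrite -[LHS]/(reduced _) -cats1 cat_rcons reduced_glue rg /reduced /= andbT.
by exists (inv_letter z); rewrite -!rz; split=> // y; rewrite rz.
Qed.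

(** No cancellation occurs within the powers of [r] or against [g], so the vertices [g r^i] run to
    infinity in the direction [y]. *)
Lemma word_ray g r y s i :
    word r = y :: s -> cycle nocancel (word r) -> reduced (rcons (word g) y) ->
  i <= fg_length (g * r ^+ i)%g /\
  (0 < i -> exists t, word (g * r ^+ i)%g = rcons (word g) y ++ t).
Proof.
move=> ry cr gy; case: i => [//|i].
have E : word (g * r ^+ i.+1)%g = rcons (word g) y ++ (s ++ flatten (nseq i (word r))).
  have ci : reduced (y :: (s ++ flatten (nseq i (word r)))).
    by have := cycle_reduced (cycle_pow i.+1 cr); rewrite /= {1}ry.
  by rewrite cat_rcons word_mul word_exp//= ry//= -ry reduced_glue gy ci.
split; last by exists (s ++ flatten (nseq i (word r))).
rewrite /fg_length E !size_cat size_rcons.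
suff : i <= size (flatten (nseq i (word r))) by lia.
elim: i {E} => //= i IHi; rewrite size_cat ry /= -ry; lia.
Qed.

(** For each subword [x y] of [u], a translate of the axis of a conjugate of [u] passes through the
    extremal vertex, with ends in the directions [inv_letter x] and [y]. Its two ends have the same
    colour, so [S] separates these directions only if one of them is [v]. *)
Lemma cut_vertex : cycle nocancel (word u) ->
  exists v S, nontrivial_cut v S /\ sorted (turn v S) (word u).
Proof.
move=> cyc; have [g [v [S [N [vS gv SP]]]]] := extremal_vertex.
have [cu cq _] := uc.
have cuV h : c (h * u^-1)%g = c h by rewrite -[LHS]cu mulgVK.
have cX e : (forall h, c (h * e)%g = c h) -> forall h i, c (h * e ^+ i)%g = c h.
  by move=> ce h; elim=> [|i IHi]; rewrite ?mulg1// expgSr mulgA ce.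
exists v, S; split=> //.
have x0 : 'I_n * bool by exact: v.
apply/(sortedP x0) => i iu; set x := nth x0 _ i; set y := nth x0 _ _.
apply/andP; split; first exact: (sortedP x0 (word_reduced u)).
have [//|xv /=] := eqVneq; have [//|yv /=] := eqVneq.
have uE := cat_take_drop i.+1 (word u).
have [rp rs] : reduced (take i.+1 (word u)) /\ reduced (drop i.+1 (word u)).
  have := word_reduced u; rewrite -{1}uE => rr.
  by split; [apply: reduced_catl rr|apply: reduced_catr rr].
pose p : freeG n := FreeGroup rp; pose s : freeG n := FreeGroup rs.
have ups : u = (p * s)%g.
  by apply: word_inj; rewrite word_mul /= uE// word_reduced.
have cw : cycle nocancel (rot i.+1 (word u)) by rewrite rot_cycle.
have rE : word (s * p)%g = rot i.+1 (word u).
  by rewrite word_mul//; apply: cycle_reduced cw.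
(* This is [p^-1 u p], the rotation of [u] that starts at [y]; its inverse starts with
   [inv_letter x]. *)
set r := (s * p)%g in rE.
have [t1 ry] : exists t, word r = y :: t.
  exists (drop i.+2 (word u) ++ take i.+1 (word u)).
  by rewrite rE /rot (drop_nth x0).
have [t2 rx] : exists t, word r^-1%g = inv_letter x :: t.
  rewrite word_inv rE /rot (take_nth x0) 1?ltnW// -rcons_cat map_rcons rev_rcons.
  by eexists.
have [M MP] := cq p^-1%g.
have rp1 : (r * p^-1 = p^-1 * u)%g by rewrite /r ups mulgK mulKg.
have rp2 : (r^-1 * p^-1 = p^-1 * u^-1)%g.
  by rewrite -!invgM; congr (_^-1)%g; rewrite /r ups mulgA.
pose k := (N + M).+1.
have crV : cycle nocancel (word r^-1%g) by rewrite word_inv rE; apply: cycle_inv.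
rewrite -rE in cw.
have [l1 /(_ isT)[w1 e1]] := word_ray k ry cw (gv _ yv).
have [l2 /(_ isT)[w2 e2]] := word_ray k rx crV (gv _ xv).
have Nk : N <= k by rewrite /k; lia.
have Mk : M <= k by rewrite /k; lia.
(* At depth at least [M] a shift by [p^-1] preserves the colour, and [g r^k p^-1 = g p^-1 u^k] has
   the colour of [g p^-1]; the same holds along the powers of [r^-1]. *)
rewrite -(SP _ _ _ (leq_trans Nk l1) e1) -(SP _ _ _ (leq_trans Nk l2) e2).
rewrite -(MP _ (leq_trans Mk l1)) -(MP _ (leq_trans Mk l2)) -!mulgA.
by rewrite (expg_intertwine _ rp1) (expg_intertwine _ rp2) !mulgA !cX.
Qed.

End CutVertex.

(** * Counting words whose consecutive letters satisfy a relation *)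

Section Words.
Variable T : finType.

Fixpoint words k : seq (seq T) :=
  if k is k'.+1 then [seq x :: s | x <- index_enum T, s <- words k'] else [:: [::]].

Lemma mem_words s k : (s \in words k) = (size s == k).
Proof.
elim: k s => [|k IHk] [|x s] //=; first by apply/negP => /allpairsP[? []].
rewrite eqSS -IHk; apply/allpairsP/idP => [[[y t] /= [_ ts [_ ->]]]//|sk].
by exists (x, s); rewrite mem_index_enum.
Qed.

Lemma words_uniq k : uniq (words k).
Proof.
elim: k => //= k IHk; apply: allpairs_uniq; rewrite ?index_enum_uniq//.
by move=> [x s] [y t] _ _ [-> ->].
Qed.

Lemma count_wordsS (P : pred (seq T)) k :
  count P (words k.+1) = \sum_(x : T) count (fun s => P (x :: s)) (words k).
Proof.
rewrite /= count_flatten sumnE !big_map; apply: eq_bigr => x _.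
by rewrite count_map.
Qed.

Lemma count_path_wordsS (M : rel T) x k :
  count (path M x) (words k.+1) = \sum_(y | M x y) count (path M y) (words k).
Proof.
rewrite count_wordsS [RHS]big_mkcond; apply: eq_bigr => y _ /=.
by case: (M x y) => //=; rewrite count_pred0.
Qed.

(** The weight [f] is a positive super-eigenvector of the transfer matrix of [M], so each further
    letter costs at most a factor [m]. *)
Lemma count_path_le (M : rel T) (f : T -> nat) m :
    (forall x, 0 < f x) -> (forall x, \sum_(y | M x y) f y <= m * f x) ->
  forall k x, count (path M x) (words k) <= m ^ k * f x.
Proof.
move=> f0 fM; elim=> [|k IHk] x; first by rewrite /= mul1n addn0 f0.
rewrite count_path_wordsS; apply: (@leq_trans (\sum_(y | M x y) m ^ k * f y)).
  exact: leq_sum.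
by rewrite -big_distrr /= expnSr -mulnA leq_mul2l fM orbT.
Qed.

Lemma count_path_ge (M : rel T) d :
    (forall x, d <= #|[pred y | M x y]|) ->
  forall k x, d ^ k <= count (path M x) (words k).
Proof.
move=> dM; elim=> [|k IHk] x //.
rewrite count_path_wordsS; apply: (@leq_trans (\sum_(y | M x y) d ^ k)).
  by rewrite sum_nat_const expnS leq_mul2r dM orbT.
exact: leq_sum.
Qed.

Lemma sum_excluded (P : pred T) (f : T -> nat) s : uniq s ->
    {in s, forall e, ~~ P e} ->
  \sum_(y | P y) f y + \sum_(e <- s) f e <= \sum_y f y.
Proof.
move=> us sP; rewrite [leqRHS](bigID P) /= leq_add2l big_uniq//=.
rewrite big_mkcond [leqRHS]big_mkcond; apply: leq_sum => y _ /=.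
by case: ifP => // /sP ->.
Qed.

Lemma sum_indicator (a : T) : \sum_y (y == a : nat) = 1.
Proof. by rewrite (bigD1 a)//= eqxx big1// => y /negPf ->. Qed.

Lemma count_exists_le (I : finType) (Q : I -> pred (seq T)) s :
  count (fun w => [exists p, Q p w]) s <= \sum_p count (Q p) s.
Proof.
elim: s => [|w s IHs] /=; first by rewrite big1.
rewrite big_split /= leq_add//; case: existsP => //= -[p Qp].
by rewrite (bigD1 p)//= Qp.
Qed.

Lemma count_predI_predC (a b : pred (seq T)) s :
  count a s = count (predI a b) s + count (predI a (predC b)) s.
Proof. by elim: s => //= w s ->; case: (a w) (b w) => -[] /=; lia. Qed.

End Words.

(** * Weights adapted to a cut, with growth factor [2n-2] *)

Section Weights.
Variable n : nat.
Hypothesis n2 : 2 <= n.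
Local Notation L := ('I_n * bool)%type.
Implicit Types (x y v : L) (S : {ffun L -> bool}) (f : L -> nat).

Lemma letter_neq_inv x : x != inv_letter x.
Proof. by case: x => a []; rewrite xpair_eqE eqxx. Qed.

Lemma card_letters : #|{: L}| = n.*2.
Proof. by rewrite card_prod card_ord card_bool muln2. Qed.

Definition cut_weight v S f :=
  (forall x, 0 < f x <= 4) /\
  (forall x, \sum_(y | turn v S x y) f y <= (n.*2 - 2) * f x).

Lemma turn_excl v S x : ~~ turn v S x (inv_letter x).
Proof. by rewrite /turn /nocancel (eqxx (inv_letter x)). Qed.

Lemma turn_excl_cut v S x y : inv_letter x != v -> y != v ->
  S y != S (inv_letter x) -> ~~ turn v S x y.
Proof. by move=> /negPf xv /negPf yv; rewrite eq_sym /turn xv yv => /negPf ->; rewrite andbF. Qed.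

Lemma turn_opp v S x y : turn v [ffun z => ~~ S z] x y = turn v S x y.
Proof. by rewrite /turn !ffunE (inj_eq negb_inj). Qed.

(** The letter [inv_letter v] may be followed by everything except [v], so it has the most
    successors and gets the larger weight. *)
Definition weight24 v y := if y == inv_letter v then 4 else 2.

Lemma weight24_ge2 v y : 2 <= weight24 v y.
Proof. by rewrite /weight24; case: ifP. Qed.

Lemma sum_weight24 v : \sum_y weight24 v y = 4 * n + 2.
Proof.
rewrite /weight24; move: (inv_letter v) => {}v.
rewrite (eq_bigr (fun y => 2 + 2 * (y == v))) => [|y _]; last by case: eqP.
rewrite big_split /= -big_distrr /= sum_indicator sum_nat_const card_letters; lia.
Qed.

(** Each [x] other than [inv_letter v] excludes its inverse and two letters across the cut, leaving
    at most [4n+2-6 = 2(2n-2)]. After [inv_letter v] at most [4n] remains, and [4n <= 4(2n-2)]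
    because [n >= 2]. *)
Lemma cut_weight_large v S a a' b b' : a != v -> a' != v -> b != v -> b' != v ->
    a != a' -> b != b' -> S a -> S a' -> ~~ S b -> ~~ S b' ->
  cut_weight v S (weight24 v).
Proof.
move=> av a'v bv b'v aa' bb' Sa Sa' Sb Sb'; split=> x; first by rewrite /weight24; case: ifP.
have f2 := weight24_ge2 v; have fS := sum_weight24 v.
have ex s := @sum_excluded _ (turn v S x) (weight24 v) s.
have [xv|xv] := eqVneq x (inv_letter v).
  have /(ex [:: v] isT) : {in [:: v], forall y, ~~ turn v S x y}.
    by move=> y; rewrite inE => /eqP ->; have := turn_excl v S x; rewrite xv inv_letterK.
  by rewrite big_seq1 fS [weight24 v x]/weight24 xv eqxx; have := f2 v; lia.
have Vxv : inv_letter x != v by rewrite -(inj_eq inv_letter_inj) inv_letterK.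
have [d [d' [dv d'v dd' Sd Sd']]] : exists d d',
    [/\ d != v, d' != v, d != d', S d != S (inv_letter x) & S d' != S (inv_letter x)].
  case: (S (inv_letter x)); [exists b, b'|exists a, a'];
    by rewrite ?(negPf Sb) ?(negPf Sb') ?Sa ?Sa'.
have us : uniq [:: inv_letter x; d; d'].
  rewrite /= !inE dd' andbT negb_or andbT.
  by apply/andP; split; [apply: contraNneq Sd => ->|apply: contraNneq Sd' => ->].
have /(ex _ us) : {in [:: inv_letter x; d; d'], forall y, ~~ turn v S x y}.
  move=> y; rewrite !inE => /or3P[]/eqP ->; rewrite ?turn_excl//; exact: turn_excl_cut.
rewrite !big_cons big_nil fS [weight24 v x]/weight24 (negPf xv).
by move: (f2 (inv_letter x)) (f2 d) (f2 d'); clear -n2; lia.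
Qed.

(** The single successor [v] of [inv_letter a] lets the weight of [inv_letter a] drop to 1, while
    [a], which few letters may precede, takes 3. In rank 2 the inequality at [inv_letter v] requires
    weight 4; in higher rank 3 suffices and keeps the total small enough for the remaining
    letters. *)
Definition weight_leaf v a y :=
  if y == inv_letter v then (if n == 2 then 4 else 3) else
  if y == a then 3 else if y == inv_letter a then 1 else 2.

Lemma sum_weight_leaf v a : inv_letter v != a -> v != a ->
  \sum_y weight_leaf v a y = 4 * n - 2 + (if n == 2 then 4 else 3).
Proof.
move=> Vva va; have aVa : a != inv_letter a := letter_neq_inv a.
have VvVa : inv_letter v != inv_letter a by rewrite (inj_eq inv_letter_inj).
have : \sum_y (weight_leaf v a y + (y == inv_letter a)) =
    \sum_y (2 + (y == a) + (if n == 2 then 2 else 1) * (y == inv_letter v)).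
  apply: eq_bigr => y _; rewrite /weight_leaf.
  have [->|yv] := eqVneq y (inv_letter v); first by rewrite (negPf Vva) (negPf VvVa); case: ifP.
  have [->|ya] := eqVneq y a; first by rewrite (negPf aVa) muln0.
  by case: eqP => _; rewrite muln0.
rewrite !big_split /= -big_distrr /= !sum_indicator sum_nat_const card_letters.
by case: ifP; lia.
Qed.

(* When one side of the cut is a single letter [a], occurrences of
   [inv_letter a] are always followed by [v]. *)
Lemma cut_weight_leaf v S a : a != v -> S a ->
    (forall y, y != v -> S y -> y = a) -> exists f, cut_weight v S f.
Proof.
move=> av Sa Sv; have Vxv x : (inv_letter x == v) = (x == inv_letter v).
  by rewrite -(inj_eq inv_letter_inj) inv_letterK.
have only_v x y : inv_letter x = a -> turn v S x y -> y = v.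
  move=> xa; apply: contraTeq => yv.
  have [->|ya] := eqVneq y a; first by rewrite -xa turn_excl.
  by apply: turn_excl_cut; rewrite ?xa// Sa; apply: contraNneq ya => /Sv ->.
have turn_va x : x = inv_letter a -> forall f, \sum_(y | turn v S x y) f y <= f v.
  move=> xa f; rewrite big_mkcond (bigD1 v)//= big1 => [|y /negPf yv].
    by rewrite addn0; case: ifP.
  by case: ifP => // t; move: yv; rewrite (only_v x y) ?eqxx// xa inv_letterK.
have ex_a x f : x != inv_letter v -> x != inv_letter a ->
    \sum_(y | turn v S x y) f y + (f (inv_letter x) + f a) <= \sum_y f y.
  move=> xv xa; have Vxa : a != inv_letter x.
    by rewrite -(inj_eq inv_letter_inj) inv_letterK eq_sym.
  have us : uniq [:: inv_letter x; a] by rewrite /= inE eq_sym Vxa.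
  have /(sum_excluded f us) : {in [:: inv_letter x; a], forall y, ~~ turn v S x y}.
    move=> y; rewrite !inE => /orP[]/eqP ->; rewrite ?turn_excl//.
    apply: turn_excl_cut => //; rewrite ?Vxv// Sa.
    apply: contraNneq Vxa => /esym Sx; apply/eqP/esym/Sv => //.
    by rewrite Vxv.
  by rewrite !big_cons big_nil addn0.
have ex_v f : \sum_(y | turn v S (inv_letter v) y) f y + f v <= \sum_y f y.
  have := @sum_excluded _ (turn v S (inv_letter v)) f [:: v] isT.
  rewrite big_seq1; apply=> y; rewrite inE => /eqP ->.
  by have := turn_excl v S (inv_letter v); rewrite inv_letterK.
(* If [a] is [inv_letter v], then [weight24] works: excluding [a] alone removes weight 4, as much as
   two ordinary letters. *)
have [Vva|Vva] := eqVneq (inv_letter v) a.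
  exists (weight24 v); split=> x; first by rewrite /weight24; case: ifP.
  have f2 := weight24_ge2 v; have fS := sum_weight24 v.
  have [xv|xv] := eqVneq x (inv_letter v).
    rewrite xv; have := ex_v (weight24 v); rewrite fS.
    by rewrite [weight24 v (inv_letter v)]/weight24 eqxx; have := f2 v; lia.
  have [xa|xa] := eqVneq x (inv_letter a).
    apply: leq_trans (turn_va _ xa _) _.
    have -> : x = v by rewrite xa -Vva inv_letterK.
    by rewrite leq_pmull// subn_gt0; lia.
  have := ex_a x (weight24 v) xv xa; rewrite fS -Vva [weight24 v (inv_letter v)]/weight24 eqxx.
  rewrite [weight24 v x]/weight24 (negPf xv).
  by move: (f2 (inv_letter x)); clear -n2; lia.
have vVa : v != inv_letter a by rewrite -(inj_eq inv_letter_inj) inv_letterK.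
have aVa : a != inv_letter a := letter_neq_inv a.
have vVv : v != inv_letter v := letter_neq_inv v.
have va : v != a by rewrite eq_sym.
have fS := sum_weight_leaf Vva va; pose f := weight_leaf v a; rewrite -/f in fS.
have VaVv : inv_letter a != inv_letter v by rewrite (inj_eq inv_letter_inj).
have aVv : a != inv_letter v by rewrite eq_sym.
have fv : f v = 2 by rewrite /f /weight_leaf (negPf vVv) (negPf va) (negPf vVa).
have fa : f a = 3 by rewrite /f /weight_leaf (negPf aVv) eqxx.
have fVa : f (inv_letter a) = 1.
  by rewrite /f /weight_leaf (negPf VaVv) eq_sym (negPf aVa) eqxx.
have fVv : f (inv_letter v) = if n == 2 then 4 else 3.
  by rewrite /f /weight_leaf eqxx.
have f2 y : y != a -> y != inv_letter a -> y != inv_letter v -> f y = 2.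
  by rewrite /f /weight_leaf => /negPf -> /negPf -> /negPf ->.
exists f; split=> x; first by rewrite /f /weight_leaf; do ! case: ifP.
have [->|xv] := eqVneq x (inv_letter v).
  move: (ex_v f); rewrite fS fVv fv; move: n2 (\sum_(y | _) f y); clear.
  by case: eqP => [->|]; lia.
have [xa|xa] := eqVneq x (inv_letter a).
  apply: leq_trans (turn_va _ xa f) _; rewrite fv xa fVa; move: n2; clear; lia.
have := ex_a x f xv xa; rewrite fS fa.
have [->|xv'] := eqVneq x v; first by rewrite fVv fv; move: n2 (\sum_(y | _) f y); clear; case: eqP; lia.
have [->|xa'] := eqVneq x a.
  by rewrite fVa fa; move: n2 (\sum_(y | _) f y); clear; case: eqP => [->|]; lia.
(* In rank 2 the letters [v], [a] and their inverses are all there are, so a fifth letter [x] forces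
   [n >= 3]. *)
have n3 : n != 2.
  apply/eqP => n_2; have us : uniq [:: v; inv_letter v; a; inv_letter a; x].
    rewrite /= !inE !negb_or vVv va vVa aVa Vva !(eq_sym _ x) xv' xv xa' xa.
    by rewrite (eq_sym (inv_letter v)) VaVv.
  have := max_card [in [:: v; inv_letter v; a; inv_letter a; x]].
  by rewrite (card_uniqP us) card_letters /=; move: n_2; clear; lia.
rewrite (negPf n3) !f2//; first by move: n2 n3 (\sum_(y | _) f y); clear; lia.
- by apply: contraNneq xa => <-; rewrite inv_letterK.
- by rewrite (inj_eq inv_letter_inj).
- by rewrite (inj_eq inv_letter_inj).
Qed.

Lemma nontrivial_cut_weight v S : nontrivial_cut v S -> exists f, cut_weight v S f.
Proof.
move=> /andP[/existsP[a /andP[av Sa]] /existsP[b /andP[bv Sb]]].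
have [a'P|noa] := boolP [exists a', [&& a' != v, a != a' & S a']]; last first.
  apply: (cut_weight_leaf av Sa) => y yv Sy; apply/eqP; rewrite eq_sym.
  by apply: contraNT noa => ay; apply/existsP; exists y; rewrite yv ay Sy.
(* A complement with a single letter reduces to the leaf case by exchanging the two sides of the
   cut, which leaves [turn] unchanged. *)
have [b'P|nob] := boolP [exists b', [&& b' != v, b != b' & ~~ S b']]; last first.
  have [|y yv|f [f0 fS]] := @cut_weight_leaf v [ffun z => ~~ S z] b bv.
  - by rewrite ffunE.
  - rewrite ffunE => Sy; apply/eqP; rewrite eq_sym.
    by apply: contraNT nob => ay; apply/existsP; exists y; rewrite yv ay Sy.
  - exists f; split=> // x; rewrite -(eq_bigl _ _ (turn_opp v S x)); exact: fS.
case/existsP: a'P => a' /and3P[a'v aa' Sa']; case/existsP: b'P => b' /and3P[b'v bb' Sb'].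
exists (weight24 v); exact: (@cut_weight_large v S a a' b b').
Qed.

End Weights.

(** * Sphere sizes and the number of splittable words *)

Section Counting.
Local Open Scope classical_set_scope.
Variable n : nat.
Local Notation L := ('I_n * bool)%type.

Definition word_in (X : freeG n -> Prop) (w : seq L) : bool :=
  `[< exists2 u, word u = w & X u >].

Lemma setcard_sphere (X : set (freeG n)) k :
  setcard (X `&` sphere n k) = count (word_in X) (words L k).
Proof.
have fX : finite_set (X `&` sphere n k) by apply: finite_setIr; apply: finite_sphere.
rewrite /setcard -size_filter -(size_map (@word _)); apply/perm_size/uniq_perm.
- by rewrite map_inj_uniq ?fset_uniq//; apply: word_inj.
- by rewrite filter_uniq ?words_uniq.
move=> w; rewrite mem_filter mem_words; apply/mapP/andP => [[u]|[]].
  rewrite in_fset_set// inE => -[Xu uk] ->; split; last by rewrite -uk.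
  by apply/asboolP; exists u.
move=> /asboolP[u <- Xu] /eqP uk; exists u => //.
by rewrite in_fset_set// inE.
Qed.

Lemma setcard_disc_le (X : set (freeG n)) k :
  setcard (X `&` disc n k) <= \sum_(i < k.+1) setcard (X `&` sphere n i).
Proof.
elim: k => [|k IHk].
  rewrite big_ord1 (_ : disc n 0 = sphere n 0)//.
  by apply/seteqP; split=> u; rewrite /disc /sphere /= leqn0 => /eqP.
rewrite big_ord_recr /=; apply: leq_trans (_ : _ <= setcard (X `&` disc n k) +
  setcard (X `&` sphere n k.+1)) _; last by rewrite leq_add2r.
have -> : X `&` disc n k.+1 = (X `&` disc n k) `|` (X `&` sphere n k.+1).
  rewrite -setIUr; congr (_ `&` _); apply/seteqP; split=> u; rewrite /disc /sphere /=.
    by rewrite leq_eqVlt => /orP[/eqP|]; [right|left].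
  by case=> [/leqW//|->].
rewrite /setcard fset_setU; first by rewrite cardfsU leq_subr.
  by apply: finite_setIr; apply: finite_disc.
by apply: finite_setIr; apply: finite_sphere.
Qed.

Lemma sphere_le_disc k : setcard (sphere n k) <= setcard (disc n k).
Proof.
apply: fsubset_leq_card; rewrite -fset_set_sub; [|exact: finite_sphere|exact: finite_disc].
by move=> u; rewrite /sphere /disc /= => ->.
Qed.

Lemma card_nocancel (x : L) : #|[pred y | nocancel x y]| = n.*2.-1.
Proof.
by rewrite -(card_letters n) -(cardC1 (inv_letter x)); apply: eq_card => y; rewrite !inE.
Qed.

(** Only reduced words that may follow one fixed letter are counted, which gives [2n-1] choices at
    every position, including the first. *)
Lemma card_sphere_ge k : 1 <= n -> n.*2.-1 ^ k <= setcard (sphere n k).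
Proof.
move=> n1; rewrite -[sphere n k]setTI setcard_sphere.
apply: (@leq_trans (count (path nocancel (Ordinal n1, false)) (words L k))).
  by apply: count_path_ge => x; rewrite card_nocancel.
apply: sub_count => w /path_sorted rw; apply/asboolP.
by exists (FreeGroup (rw : reduced w)).
Qed.

Hypothesis n2 : 2 <= n.
Local Notation m := (n.*2 - 2).
Local Notation split_word := (word_in (@splittable _)).

(** The number of pairs [(v, S)], times [2n] first letters of weight at most 4. *)
Definition cyclic_bound := #|{: L * {ffun L -> bool}}| * (8 * n).

Lemma count_turn_le v S k : nontrivial_cut v S ->
  count (sorted (turn v S)) (words L k) <= 8 * n * m ^ k.
Proof.
move=> /(nontrivial_cut_weight n2)[f [f14 fS]]; have m2 : 2 <= m by lia.
case: k => [|k]; first by rewrite /= muln1; lia.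
rewrite count_wordsS /=; apply: (@leq_trans (\sum_(x : L) m ^ k * 4)).
  apply: leq_sum => x _; apply: (@leq_trans (m ^ k * f x)).
    by apply: count_path_le => // y; case/andP: (f14 y).
  by rewrite leq_mul2l; case/andP: (f14 x) => _ ->; rewrite orbT.
rewrite sum_nat_const card_letters expnS.
have -> : n.*2 * (m ^ k * 4) = 8 * n * m ^ k by rewrite -muln2; lia.
by rewrite leq_mul2l leq_pmull ?orbT//; lia.
Qed.

Lemma count_cyclic_split_le k :
  count (predI split_word (cycle nocancel)) (words L k) <= cyclic_bound * m ^ k.
Proof.
pose Q (p : L * {ffun L -> bool}) (w : seq L) :=
  nontrivial_cut p.1 p.2 && sorted (turn p.1 p.2) w.
apply: (@leq_trans (count (fun w => [exists p, Q p w]) (words L k))).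
  apply: sub_count => w /= /andP[/asboolP[u <- [c uc]] cyc].
  have [v [S [vS uS]]] := cut_vertex n2 uc cyc.
  by apply/existsP; exists (v, S); rewrite /Q vS.
apply: leq_trans (count_exists_le _ _) _.
rewrite /cyclic_bound -mulnA -sum_nat_const; apply: leq_sum => -[v S] _.
have [vS|vS] := boolP (nontrivial_cut v S).
  apply: leq_trans (count_turn_le k vS); apply: sub_count => w.
  by rewrite /Q => /andP[].
by rewrite (eq_count (_ : Q _ =1 pred0)) ?count_pred0// => w; rewrite /Q (negPf vS).
Qed.

(** A reduced word that is not cyclically reduced is [l s l^-1], and [s] is again splittable by
    conjugation. *)
Lemma count_split_rec k :
  count split_word (words L k.+2) <=
    cyclic_bound * m ^ k.+2 + m.+1 * count split_word (words L k).
Proof.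
rewrite (count_predI_predC _ (cycle nocancel)) leq_add ?count_cyclic_split_le//.
pose R s := [seq l <- index_enum L | reduced (l :: rcons s (inv_letter l))].
apply: (@leq_trans (size [seq l :: rcons s (inv_letter l) |
    s <- [seq s <- words L k | split_word s], l <- R s])).
  rewrite -size_filter; apply: uniq_leq_size; first by rewrite filter_uniq ?words_uniq.
  move=> w; rewrite mem_filter mem_words => /andP[/andP[/asboolP[u uw [c uc]] cw] wk].
  case: w wk cw uw => // l w; case/lastP: w => // w y wk cw uw.
  have rw := word_reduced u; rewrite uw in rw.
  have yl : y = inv_letter l.
    apply/eqP; move: cw; rewrite /= rcons_path last_rcons [path _ _ _]rw /= negbK.
    by move=> /eqP ->; rewrite inv_letterK.
  apply/allpairsPdep; exists w, l; split; last by rewrite yl.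
    rewrite mem_filter mem_words; apply/andP; split; last by move: wk; rewrite /= size_rcons.
    apply/asboolP; exists ((letter l)^-1 * u * letter l)%g; last first.
      by apply: splittable_conj; exists c.
    have rwy : reduced (rcons w y).
      by move: rw; rewrite -[l :: _]cat1s => /reduced_catr.
    have rw' : reduced w by move: rwy; rewrite -cats1 => /reduced_catl.
    have -> : u = (letter l * (FreeGroup rw' * letter y))%g.
      apply: word_inj; rewrite uw word_mul word_mul /= cats1//.
    by rewrite yl letter_inv mulKg mulgVK.
  by rewrite mem_filter mem_index_enum andbT -yl.
rewrite size_allpairs_dep sumnE big_map.
apply: (@leq_trans (\sum_(s <- [seq s <- words L k | split_word s]) m.+1)); last first.
  by rewrite big_const_seq count_predT iter_addn_0 size_filter.
(* For empty [s] the word [l l^-1] is not reduced; otherwise [l] avoids the inverse of the first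
   letter of [s], which leaves [m+1 = 2n-1] choices. *)
apply: leq_sum => -[|y s] _; rewrite size_filter.
  by rewrite (eq_count (_ : _ =1 pred0)) ?count_pred0// => l; rewrite /reduced /= eqxx.
apply: (@leq_trans (count (nocancel y) (index_enum L))).
  apply: sub_count => l /=; rewrite /reduced /= => /andP[+ _].
  by apply: contraNN => /eqP ->; rewrite inv_letterK.
by rewrite -sum1_count sum1_card card_nocancel; lia.
Qed.

(** Induction in steps of two. The factor 4 closes the recursion because [m^2 + 4(m+1) <= 4 m^2] for
    [m >= 2]; in lengths 0 and 1 every word is cyclically reduced. *)
Lemma count_split_le k : count split_word (words L k) <= 4 * cyclic_bound * m ^ k.
Proof.
have cyc i : i < 2 -> count split_word (words L i) <= 4 * cyclic_bound * m ^ i.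
  move=> i2; apply: (@leq_trans (cyclic_bound * m ^ i)); last by lia.
  apply: leq_trans (count_cyclic_split_le i); apply/eq_leq/eq_in_count => w.
  rewrite mem_words /= => /eqP wi; apply/esym/andb_idr => _.
  case: w wi => [|x [|y w]] //=; last by lia.
  by rewrite /nocancel letter_neq_inv.
suff : count split_word (words L k) <= 4 * cyclic_bound * m ^ k /\
       count split_word (words L k.+1) <= 4 * cyclic_bound * m ^ k.+1 by case.
elim: k => [|k [IHk IHk1]]; first by split; apply: cyc.
split=> //; apply: leq_trans (count_split_rec k) _; rewrite !expnS.
have m2 : 2 <= m by lia.
move: IHk; move: (count _ _) cyclic_bound m m2 => c C p p2.
move: (p ^ k) => e ce.
apply: (@leq_trans (C * (p * (p * e)) + p.+1 * (4 * C * e))).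
  by rewrite leq_add2l leq_mul2l ce orbT.
nia.
Qed.

End Counting.

(** * Explicit primitive elements and the lower bound *)

Lemma primitive_image_gen n (phi psi : freeG n -> freeG n) i :
    {morph phi : g h / (g * h)%g} -> {morph psi : g h / (g * h)%g} ->
    cancel phi psi -> cancel psi phi ->
  primitive n (phi (gen i)).
Proof.
move=> phiM psiM phiK psiK; pose B := range (fun j => phi (gen j)).
have Bj j : B (phi (gen j)) by exists j.
exists B => //; pose b j : B := SigSub (mem_set (Bj j)).
rewrite /free_basis; set lift := fg_lift _; pose rho := fg_lift (fun j => gen (b j)).
have liftM : {morph lift : g h / (g * h)%g} by exact: fg_liftM.
have rhoM : {morph rho : g h / (g * h)%g} by exact: fg_liftM.
have lift_rho : lift \o rho =1 phi.
  apply: morph_ext => // [g h|j] /=; first by rewrite rhoM liftM.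
  by rewrite /rho /lift !fg_lift_gen.
exists (rho \o psi) => [|h]; last by rewrite /= [lift _]lift_rho psiK.
apply: (@morph_ext _ _ (rho \o psi \o lift) id) => // [g h|c] /=.
  by rewrite liftM psiM rhoM.
have [j _ cj] := set_valP c; rewrite /lift fg_lift_gen -cj phiK /rho fg_lift_gen.
by congr gen; apply: val_inj.
Qed.

Lemma fg_lift_id n (f : 'I_n -> freeG n) (g : freeG n) :
  {in word g, forall l, f l.1 = gen l.1} -> fg_lift f g = g.
Proof.
move=> fg; rewrite -[RHS](_ : fg_lift (@gen _) g = g).
  by apply: eq_big_seq => l /fg ->.
by apply: (@morph_ext _ _ _ id) => //; [apply: fg_liftM|apply: fg_lift_gen].
Qed.

(** The map sending [gen i] to [gen i * g] and fixing the other generators fixes [g], so it is an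
    automorphism, inverted by the same map for [g^-1]. *)
Lemma primitive_gen_mul n (i : 'I_n) (g : freeG n) :
  {in word g, forall l, l.1 != i} -> primitive n (gen i * g)%g.
Proof.
move=> gi; pose f h j : freeG n := if j == i then (gen i * h)%g else gen j.
have fg h : fg_lift (f h) g = g.
  by apply: fg_lift_id => l /gi /negPf; rewrite /f => ->.
have fK h h' : fg_lift (f h) h' = h' -> (h * h' = 1)%g ->
    cancel (fg_lift (f h')) (fg_lift (f h)).
  move=> hh' hV; apply: (@morph_ext _ _ (fg_lift (f h) \o fg_lift (f h')) id) => //.
    by move=> u v /=; rewrite !fg_liftM.
  move=> j /=; rewrite fg_lift_gen {2}/f; case: eqP => [->|/eqP/negPf ji].
    by rewrite fg_liftM hh' fg_lift_gen /f eqxx -mulgA hV mulg1.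
  by rewrite fg_lift_gen /f ji.
have -> : (gen i * g)%g = fg_lift (f g) (gen i) by rewrite fg_lift_gen /f eqxx.
apply: (@primitive_image_gen _ _ (fg_lift (f g^-1%g))); try exact: fg_liftM.
  by apply: fK; rewrite ?fg ?mulVg.
by apply: fK; rewrite ?mulgV// fg_liftV fg.
Qed.

Lemma num_primitive_ge n k : 1 <= n -> (n.*2 - 3) ^ k <= num_primitive n k.+1.
Proof.
move=> n1; pose i := Ordinal n1; pose x : 'I_n * bool := (i, false).
pose M (y z : 'I_n * bool) := nocancel y z && (z.1 != i).
rewrite /num_primitive setcard_sphere count_wordsS (bigD1 x)//=.
apply: leq_trans (leq_addr _ _).
apply: (@leq_trans (count (path M x) (words ('I_n * bool)%type k))).
  (* After [y] at most these three letters are forbidden, so at least [2n-3] remain. *)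
  apply: count_path_ge => y; pose s := [:: x; inv_letter x; inv_letter y].
  rewrite leq_subLR; apply: (@leq_trans (3 + #|predC [in s]|)).
    by rewrite -card_letters -(cardC [in s]) leq_add2r; apply: card_size.
  rewrite leq_add2l; apply: subset_leq_card.
  apply/fintype.subsetP => z; rewrite !inE !negb_or => /and3P[zx zVx zy].
  rewrite /M /nocancel zy /=; apply: contraNneq zVx => zi; move: zx.
  by case: (z) zi => j [] /= -> //; rewrite eqxx.
apply: sub_count => w Mw; apply/asboolP.
have rw : reduced (x :: w).
  by apply: sub_path Mw => y z /andP[].
exists (FreeGroup rw) => //.
have rw' : reduced w by move: rw; rewrite -cat1s => /reduced_catr.
have -> : FreeGroup rw = (gen i * FreeGroup rw')%g.
  by apply: word_inj; rewrite word_mul.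
apply: primitive_gen_mul => l /=; move: (w) (x) Mw => {rw rw'}.
elim=> // z s IHs y /= /andP[/andP[_ zi] zs]; rewrite inE => /orP[/eqP->//|].
exact: IHs zs.
Qed.

(** * The upper bound and the two densities *)

Lemma num_primitive_le n k : 2 <= n ->
  num_primitive n k <= 4 * cyclic_bound n * (n.*2 - 2) ^ k.
Proof.
move=> n2; apply: leq_trans (count_split_le n2 k).
rewrite /num_primitive setcard_sphere; apply: sub_count => w /asboolP[u <- pu].
by apply/asboolP; exists u => //; apply: primitive_splittable.
Qed.

Lemma primitive_disc_le n k : 2 <= n ->
  setcard (primitive n `&` disc n k)%classic <= 8 * cyclic_bound n * (n.*2 - 2) ^ k.
Proof.
move=> n2; apply: leq_trans (setcard_disc_le _ k) _.
have m2 : 2 <= n.*2 - 2 by lia.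
suff : \sum_(i < k.+1) 4 * cyclic_bound n * (n.*2 - 2) ^ i <=
    8 * cyclic_bound n * (n.*2 - 2) ^ k.
  by apply: leq_trans; apply: leq_sum => i _; apply: num_primitive_le.
move: (n.*2 - 2) (cyclic_bound n) m2 => m C m2; rewrite -big_distrr /=.
(* For [m >= 2] the geometric sum up to [m^k] is at most [2 m^k]. *)
rewrite (_ : 8 * C * m ^ k = 4 * C * (2 * m ^ k)); last by lia.
rewrite leq_mul2l; apply/orP; right.
elim: k => [|k IHk]; first by rewrite big_ord1.
rewrite big_ord_recr /= mul2n -addnn leq_add2r expnS.
by apply: leq_trans IHk _; rewrite leq_mul2r m2 orbT.
Qed.

(** The quotient is squeezed between 0 and [C (m/(m+1))^k]. *)
Lemma geometric_ratio_cvg0 (R : realType) (a b : nat -> nat) (C m : nat) :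
    (forall k, a k <= C * m ^ k) -> (forall k, m.+1 ^ k <= b k) ->
  ((fun k => (a k)%:R / (b k)%:R : R)%R @ \oo --> (0 : R)%R)%classic.
Proof.
move=> aC mb; have q1 : (`|m%:R / m.+1%:R : R| < 1)%R.
  rewrite ger0_norm; last by rewrite divr_ge0.
  by rewrite ltr_pdivrMr ?ltr0n// mul1r ltr_nat.
apply: squeeze_cvgr (cvg_cst _) (cvg_geometric C%:R%R q1).
apply: nearW => k /=; rewrite divr_ge0//=.
have bk : (0 < b k)%N by apply: leq_trans (mb k); rewrite expn_gt0.
rewrite ler_pdivrMr ?ltr0n// expr_div_n -!natrX.
apply: (@le_trans _ _ (C * m ^ k)%:R%R); first by rewrite ler_nat.
rewrite natrM -!mulrA ler_wpM2l//; rewrite ler_peMr//.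
by rewrite mulrC ler_pdivlMr ?mul1r ?ler_nat ?ltr0n ?expn_gt0.
Qed.

Unset Implicit Arguments.
Local Open Scope ring_scope.

Theorem theorem10p4 (R : realType) (n : nat) (hn : (2 <= n)%N) :
  has_density (primitive n) (0 : R) /\
  ((3 <= n)%N ->
   exists c1 c2 : R, [/\ 0 < c1, 0 < c2 &
     forall k : nat, (1 <= k)%N ->
       c1 * (2 * n%:R - 3) ^+ k <= (num_primitive n k)%:R /\
       (num_primitive n k)%:R <= c2 * (2 * n%:R - 2) ^+ k]).
Proof.
have sphere_ge k : ((n.*2 - 2).+1 ^ k <= setcard (sphere n k))%N.
  by rewrite (_ : (n.*2 - 2).+1 = n.*2.-1); [apply: card_sphere_ge|]; lia.
split; first split.
- exact: (geometric_ratio_cvg0 (fun k => num_primitive_le k hn) sphere_ge).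
- apply: (geometric_ratio_cvg0 (fun k => primitive_disc_le k hn)) => k.
  exact: leq_trans (sphere_ge k) (sphere_le_disc n k).
move=> n3; have castB d : (d <= 3)%N -> (n.*2 - d)%:R = 2 * n%:R - d%:R :> R.
  by move=> d3; rewrite natrB -?muln2 ?natrM 1?mulrC//; lia.
have p0 : 0 < 2 * n%:R - 3 :> R by rewrite -(castB 3%N)// ltr0n; lia.
(* The first constant absorbs the fixed initial letter of the words counted below; the successor
   makes the second visibly positive. *)
exists (2 * n%:R - 3)^-1, (4 * cyclic_bound n).+1%:R; split=> [||[//|k] _].
- by rewrite invr_gt0.
- by rewrite ltr0n.
split; first by rewrite exprS mulKf ?gt_eqF// -(castB 3%N)// -natrX ler_nat num_primitive_ge// ltnW.
rewrite -(castB 2%N)// -natrX -natrM ler_nat.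
by apply: leq_trans (num_primitive_le k.+1 hn) _; rewrite leq_mul2r leqnSn orbT.
Qed.
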